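(* $\operatorname{BR}^1_2(B_d)\geq 2d+1$ for $3\leq d\leq 8$ and for all $d\geq 13$.
   Context: $B_n$ is the Boolean lattice of subsets of $[n]$ ordered by inclusion. A copy of a poset $P$ in a poset $Q$ is the image of an injection $f:P\to Q$ with $f(x)\le f(y)$ whenever $x\le y$ (not necessarily induced). $\operatorname{BR}_2^1(P)$ is the least $N$ such that every 2-coloring of the elements of $B_N$ contains a copy of $P$ all of whose elements have the same color. *)

(* Defs.v *)
From mathcomp Require Import all_boot all_order.
Set Implicit Arguments.
Unset Strict Implicit.
Unset Printing Implicit Defensive.
Import Order.TTheory.
(* orders {set T} by inclusion *)
Export Order.DefaultSetSubsetOrder.

Notation boolean_lattice n := {set 'I_n}.

Definition poset_copy (dP dQ : Order.disp_t) (P : finPOrderType dP)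
    (Q : finPOrderType dQ) (A : {set Q}) : bool :=
  [exists f : {ffun P -> Q},
    [&& injectiveb f,
        [forall x, [forall y, (x <= y)%O ==> (f x <= f y)%O]]
      & A == f @: P]].
Arguments poset_copy {dP dQ} P {Q} A.

Definition monochromatic (T : finType) (c : T -> bool) (A : {set T}) : bool :=
  [exists k : bool, [forall x in A, c x == k]].

Definition BR_arrows (dP : Order.disp_t) (P : finPOrderType dP) (N : nat) :
    bool :=
  [forall c : {ffun boolean_lattice N -> bool},
    [exists A : {set boolean_lattice N}, poset_copy P A && monochromatic c A]].
Arguments BR_arrows {dP} P N.

Lemma poset_copyP (dP dQ : Order.disp_t) (P : finPOrderType dP)
    (Q : finPOrderType dQ) (A : {set Q}) :
  reflect (exists f : P -> Q,
             [/\ injective f, {homo f : x y / (x <= y)%O} & A = f @: P])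
          (poset_copy P A).
Proof.
apply: (iffP existsP) => [[f /and3P[/injectiveP fI /forallP fH /eqP ->]]|].
  exists f; split=> // x y xy.
  by move/forallP: (fH x) => /(_ y) /implyP; apply.
move=> [f [fI fH ->]]; exists (finfun f); apply/and3P; split.
- by apply/injectiveP => x y; rewrite !ffunE; apply: fI.
- apply/forallP => x; apply/forallP => y; apply/implyP => xy.
  by rewrite !ffunE; apply: fH.
- by apply/eqP; apply: eq_imset => x; rewrite ffunE.
Qed.

Lemma linear_extension (dP : Order.disp_t) (P : finPOrderType dP) :
  exists g : P -> nat,
    [/\ injective g, {homo g : x y / (x <= y)%O >-> x <= y}
      & forall x, g x < #|P|].
Proof.
pose down x := #|[set z : P | (z <= x)%O]|.
pose r x y := down x <= down y.
pose s := sort r (enum P).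
have sE x : x \in s by rewrite mem_sort mem_enum.
have s_sz : size s = #|P| by rewrite size_sort -cardE.
have r_tr : transitive r by move=> y x z; apply: leq_trans.
have s_sorted : sorted r s by apply: sort_sorted => x y; apply: leq_total.
exists (index^~ s); split=> [x y|x y|x].
- by apply: index_inj.
- rewrite le_eqVlt => /orP[/eqP ->//|xy].
  have dxy : down x < down y.
    apply: proper_card; apply/properP; split.
      by apply/subsetP => z; rewrite !inE => /le_trans; apply; apply: ltW.
    by exists y; rewrite !inE ?lexx // lt_geF.
  rewrite leqNgt; apply/negP => lt_yx.
  have := sorted_ltn_index r_tr s_sorted _ _ (sE y) (sE x) lt_yx.
  by rewrite /r leqNgt dxy.
- by rewrite -s_sz index_mem.
Qed.

(* Pigeonhole on the maximal chain of initial segments: a monochromatic chain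
   with #|P| elements contains a (not necessarily induced) copy of P. *)
Lemma BR_arrows_ex (dP : Order.disp_t) (P : finPOrderType dP) :
  exists N, BR_arrows P N.
Proof.
have [g [gI gH gP]] := linear_extension P.
exists (#|P| + #|P|); set N := _ + _.
apply/forallP => c.
pose A (m : nat) : boolean_lattice N := [set i : 'I_N | i < m].
have A_le m m' : m <= m' -> (A m <= A m')%O.
  move=> mm'; apply/subsetP => i; rewrite !inE => im; exact: leq_trans mm'.
have A_card m : m <= N -> #|A m| = m.
  move=> mN; rewrite -[RHS](card_ord m).
  rewrite -(card_imset predT (f := widen_ord mN)); last first.
    by move=> i j /(congr1 val) /= ?; apply: val_inj.
  apply: eq_card => i; rewrite !inE; apply/idP/imsetP => [im|[j _ ->]].
    by exists (Ordinal im) => //; apply: val_inj.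
  exact: (ltn_ord j).
pose a := fun k => [pred m | c (A m) == k].
have [k kP] : exists k, #|P| <= count (a k) (iota 0 N).
  have := count_predC (a true) (iota 0 N); rewrite size_iota.
  have -> : count (predC (a true)) (iota 0 N) = count (a false) (iota 0 N).
    by apply: eq_count => m /=; case: (c _).
  move=> E; have [?|lt1] := leqP #|P| (count (a true) (iota 0 N)).
    by exists true.
  exists false; rewrite -(leq_add2l #|P|) -/N -[X in X <= _]E leq_add2r.
  exact: ltnW.
pose s := filter (a k) (iota 0 N).
have s_sz : #|P| <= size s by rewrite size_filter.
have s_lt : sorted ltn s.
  by apply: sorted_filter; [apply: ltn_trans | apply: iota_ltn_sorted].
have gs x : g x < size s by apply: leq_trans s_sz.
have s_nth x : nth 0 s (g x) \in s by apply: mem_nth.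
have sN x : c (A (nth 0 s (g x))) = k /\ nth 0 s (g x) <= N.
  have := s_nth x; rewrite mem_filter mem_iota add0n /= => /andP[/eqP -> ?].
  by split=> //; apply: ltnW.
pose f x := A (nth 0 s (g x)).
apply/existsP; exists (f @: P); apply/andP; split.
  apply/poset_copyP; exists f; split=> // [x y fxy|x y xy].
    apply: gI; have := congr1 (fun B : {set 'I_N} => #|B|) fxy.
    rewrite /f !A_card ?(proj2 (sN _)) // => /eqP.
    rewrite nth_uniq ?gs // => [/eqP //|].
    by rewrite filter_uniq ?iota_uniq.
  apply: A_le; have := gH _ _ xy; rewrite leq_eqVlt => /orP[/eqP -> //|lt].
  apply: ltnW; apply: (sorted_ltn_nth ltn_trans) => //; exact: gs.
apply/existsP; exists k; apply/forallP => B; apply/implyP => /imsetP[x _ ->].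
by rewrite /f (proj1 (sN x)).
Qed.

(* BR_2^1(P) *)
Definition BR21 (dP : Order.disp_t) (P : finPOrderType dP) : nat :=
  ex_minn (BR_arrows_ex P).
Arguments BR21 {dP} P.

(* Main.v *)
(* Colour the sets of size 0 and 4, ..., d + 2 red, those of size 1, 2 and
   d + 3, ..., 2d blue, and the triples by a 3-graph R of red triples on the 2d
   points. Only d + 1 sizes occur among the red sets, so a red copy of B_d uses
   all of them, and, being rigid from the top down, its atoms are G + t_i for a
   pair G and d points t_i: R has a pair of codegree d. Likewise a blue copy is
   rigid from the bottom up and its rank-2 elements are v + e_i + e_j: d points
   are independent in the link of v. So it suffices that R has codegrees less
   than d and no d independent points in any link.
   For d >= 5 split the points into two copies of Z_d; the red triples are those
   inside one half and those x, y | z with x + y = z. For d = 3 and d = 4 a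
   condition on the sum of the three points does. *)
Require Import Defs.
From mathcomp Require Import all_boot all_order all_algebra zify.
Set Implicit Arguments.
Unset Strict Implicit.
Unset Printing Implicit Defensive.
Import GRing.Theory.

(** * Reduction of the lower bound to a 3-graph on 2d points *)

Definition blocking_triples (T : finType) (d : nat) (R : {set T} -> bool) :=
  (forall G E : {set T}, #|G| = 2 -> #|E| = d -> [disjoint G & E] ->
     exists2 z, z \in E & ~~ R (z |: G)) /\
  (forall v (E : {set T}), #|E| = d -> v \notin E ->
     exists x y, [/\ x \in E, y \in E, x != y & R (v |: [set x; y])]).

Lemma BR_arrows_leq (dP : Order.disp_t) (P : finPOrderType dP) (m n : nat) :
  m <= n -> BR_arrows P m -> BR_arrows P n.
Proof.
move=> le_mn /forallP arrows; apply/forallP => c.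
pose w (A : {set 'I_m}) : {set 'I_n} := widen_ord le_mn @: A.
have wI : injective w.
  by apply: imset_inj => i j /(congr1 val) /= ?; apply: val_inj.
have /existsP[A /andP[/poset_copyP[f [fI fH defA]] /existsP[k /forallP monoA]]] :=
  arrows [ffun A => c (w A)].
apply/existsP; exists [set w (f x) | x : P]; apply/andP; split.
  apply/poset_copyP; exists (w \o f); split=> //; first exact: inj_comp.
  by move=> x y /fH; exact: imsetS.
apply/existsP; exists k; apply/forallP => B; apply/implyP => /imsetP[x _ ->].
by have := monoA (f x); rewrite defA imset_f // ffunE.
Qed.

(** By injectivity, each element added to the argument strictly enlarges the image. The rigidity of
    both kinds of copies rests on this. *)
Lemma copy_card_gap (m n : nat) (f : {set 'I_m} -> {set 'I_n}) (x y : {set 'I_m}) :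
  injective f -> {homo f : x y / x \subset y} -> x \subset y ->
  #|f x| + #|y| <= #|f y| + #|x|.
Proof.
move=> fI fH; have [k] := ubnP #|y|; elim: k y => // k IHk y lt_yk xy.
have [->//|neq_xy] := eqVneq x y.
have /properP[_ [i iy ix]] : x \proper y by rewrite properEneq neq_xy.
have xy' : x \subset y :\ i by rewrite subsetD1 xy.
have cy : #|y| = (#|y :\ i|).+1 by rewrite (cardsD1 i y) iy.
have IH := IHk _ (leq_trans (_ : #|y :\ i| < #|y|) lt_yk) xy'.
have : f (y :\ i) \proper f y.
  rewrite properEneq fH ?subD1set // andbT.
  by apply/eqP => /fI e; move: iy; rewrite -e !inE eqxx.
move/proper_card; move: IH; rewrite cy ltnSn => /(_ isT); lia.
Qed.

Lemma no_red_copy (d n : nat) (R : {set 'I_n} -> bool)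
    (f : {set 'I_d} -> {set 'I_n}) :
  2 < d -> blocking_triples d R ->
  injective f -> {homo f : x y / x \subset y} ->
  (forall x, #|f x| \in [pred m | (m == 0) || (3 <= m <= d + 2)]) ->
  exists x, (#|f x| == 3) && ~~ R (f x).
Proof.
move=> d_gt2 [codegR _] fI fH red.
have gap x y := @copy_card_gap _ _ f x y fI fH.
(* The image of an atom strictly contains [f set0], so its size is nonzero and hence at least 3. *)
have size_ge x : x != set0 -> #|x| + 2 <= #|f x|.
  case/set0Pn=> i ix.
  have := gap set0 [set i] (sub0set _); rewrite cards0 cards1.
  have := gap [set i] x; rewrite sub1set cards1 => /(_ ix).
  have := red [set i]; rewrite inE; lia.
have cardT : #|[set: 'I_d]| = d by rewrite cardsT card_ord.
have cardC1 i : #|[set~ i : 'I_d]| = d.-1 by rewrite cardsC1 card_ord.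
pose T := f setT.
have cT : #|T| = d + 2.
  have := size_ge setT; rewrite -card_gt0 cardT; have := red setT; rewrite inE -/T; lia.
have cC i : #|f [set~ i]| = d.+1.
  have := size_ge [set~ i]; rewrite -card_gt0 cardC1.
  have := gap [set~ i] setT (subsetT _); rewrite cardC1 cardT -/T cT; lia.
(* Each coatom goes to [T] minus a single point, called [t i]. *)
have /fin_all_exists[t tP] i : exists t, T :\: f [set~ i] = [set t].
  by apply/cards1P; rewrite cardsDS ?fH ?subsetT // cT cC addn2 subSnn.
have tI : injective t.
  move=> i j tij; have := tP i; rewrite tij -tP => /(congr1 (setD T)).
  rewrite !setDDr !setDv !set0U !(setIidPr _) ?fH ?subsetT // => /fI e.
  apply/set1P; have : i \notin [set~ j] by rewrite -e !inE eqxx.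
  by rewrite !inE negbK.
have tT i : t i \in T by have := set11 (t i); rewrite -tP => /setDP[].
pose E := [set t i | i : 'I_d]; pose G := T :\: E.
have ET : E \subset T by apply/subsetP => _ /imsetP[i _ ->].
have cE : #|E| = d by rewrite card_imset // card_ord.
have cG : #|G| = 2 by rewrite cardsDS // cT cE addKn.
have [|z /imsetP[i _ ->] notR] := codegR G E cG cE.
  by rewrite -setI_eq0 setIDAC -setIDA setDv setI0.
(* For [j != i], [f [set i]] lies in [f [set~ j]] and so avoids [t j]; having at least 3 points, it
   fills [t i |: G]. *)
have fi : f [set i] = t i |: G.
  apply/eqP; rewrite eqEcard; apply/andP; split; last first.
    have := size_ge [set i]; rewrite -card_gt0 cards1 cardsU1 cG => /(_ isT).
    by case: (_ \notin _) => /=; lia.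
  apply/subsetP => u ui; rewrite !inE.
  have uT : u \in T by apply: subsetP ui; apply: fH; apply: subsetT.
  rewrite uT andbT; have [//|neq_u /=] := eqVneq u (t i).
  apply/negP => /imsetP[j _ uj].
  have : u \in T :\: f [set~ j] by rewrite tP uj set11.
  case/setDP=> _ /negP; apply; apply: subsetP ui; apply: fH.
  by rewrite sub1set !inE; apply: contraNneq neq_u => ->; apply/eqP.
exists [set i]; rewrite fi notR andbT cardsU1 cG.
suff -> : t i \notin G by [].
by rewrite !inE negb_and negbK imset_f.
Qed.

Lemma no_blue_copy (d : nat) (R : {set 'I_(2 * d)} -> bool)
    (f : {set 'I_d} -> {set 'I_(2 * d)}) :
  2 < d -> blocking_triples d R ->
  injective f -> {homo f : x y / x \subset y} ->
  (forall x, #|f x| \in [pred m | (0 < m <= 3) || (d + 2 < m)]) ->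
  exists x, (#|f x| == 3) && R (f x).
Proof.
move=> d_gt2 [_ linkR] fI fH blue.
have gap x y := @copy_card_gap _ _ f x y fI fH.
(* The top image has at most [2 * d] points, so the gap gives [#|f x| <= d + 2]; blue sizes in that
   range stop at 3. *)
have size_le (x : {set 'I_d}) : #|x| <= 2 -> #|f x| <= 3.
  have := gap x setT (subsetT _); rewrite cardsT card_ord.
  have := subset_leq_card (subsetT (f setT)); rewrite cardsT card_ord; have := blue x; rewrite inE; lia.
have f0_gt0 : 0 < #|f set0| by have := blue set0; rewrite inE; lia.
(* Image sizes increase strictly along [set0], [[set i]], [[set i; j]] and stay between 1 and 3, so
   they are 1, 2, 3. *)
have c1 i : #|f [set i]| = 2 /\ #|f set0| = 1.
  have [j ji] : exists j, j != i.
    apply/existsP; apply: contraLR d_gt2; rewrite negb_exists => /forallP ne.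
    rewrite -leqNgt -(card_ord d) (@leq_trans 1) // -(card1 i).
    by apply/subset_leq_card/subsetP => j _; rewrite inE -[_ == _]negbK.
  have c2 : #|[set i; j]| = 2 by rewrite cards2 eq_sym ji.
  have := size_le [set i; j]; have := gap [set i] [set i; j].
  have := gap set0 [set i]; rewrite c2 sub0set sub1set !inE eqxx cards0 cards1.
  by move=> /(_ isT) ? /(_ isT) ? /(_ isT) ?; lia.
have d_gt0 : 0 < d by lia.
have /eqP/cards1P[v f0] : #|f set0| = 1 by case: (c1 (Ordinal d_gt0)).
have /fin_all_exists[e eP] i : exists e, f [set i] :\: f set0 = [set e].
  by apply/cards1P; rewrite cardsDS ?fH ?sub0set //; case: (c1 i) => -> ->.
have f1 i : f [set i] = e i |: [set v].
  by rewrite -eP -f0 setUC setDE setUIr setUCr setIT; apply/esym/setUidPr/fH/sub0set.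
have eI : injective e.
  by move=> i j eij; apply/set1P; rewrite -(fI _ _ (_ : f [set i] = f [set j])) ?set11 // !f1 eij.
have ev i : e i != v.
  by apply/eqP => ei; have [] := c1 i; rewrite f1 ei setUid cards1.
pose E := [set e i | i : 'I_d].
have [||x [y [/imsetP[i _ ->] /imsetP[j _ ->] eij Rij]]] := linkR v E.
- by rewrite card_imset // card_ord.
- by apply/imsetP => -[i _ ve]; have := ev i; rewrite ve eqxx.
have ij : i != j by apply: contraNneq eij => ->.
exists [set i; j]; suff -> : f [set i; j] = v |: [set e i; e j].
  by rewrite Rij cardsU1 cards2 eij !inE ![v == _]eq_sym (negPf (ev i)) (negPf (ev j)).
apply/esym/eqP; rewrite eqEcard; apply/andP; split.
  have := fH [set i] [set i; j]; have := fH [set j] [set i; j].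
  rewrite !sub1set !inE !eqxx orbT !f1 !subUset !sub1set.
  by move=> /(_ isT) /andP[-> ->] /(_ isT) /andP[-> _].
by rewrite cardsU1 cards2 eij !inE ![v == _]eq_sym (negPf (ev i)) (negPf (ev j)) size_le // cards2 ij.
Qed.

Lemma blocking_triples_noarrow (d : nat) (R : {set 'I_(2 * d)} -> bool) :
  2 < d -> blocking_triples d R -> ~~ BR_arrows (boolean_lattice d) (2 * d).
Proof.
move=> d_gt2 blockR; apply/negP => /forallP arrows.
pose c (A : {set 'I_(2 * d)}) :=
  if #|A| == 3 then R A else (#|A| == 0) || (4 <= #|A| <= d + 2).
have /existsP[A /andP[/poset_copyP[f [fI fH ->]] /existsP[k /forallP mono]]] :=
  arrows [ffun A => c A].
have {}fH : {homo f : x y / x \subset y} by move=> x y; exact: fH.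
have {}mono x : c (f x) = k.
  by have := mono (f x); rewrite imset_f // ffunE => /eqP.
rewrite /c in mono; case: k mono => mono.
  have [x|x /andP[fx3 /negP[]]] := no_red_copy d_gt2 blockR fI fH.
    by rewrite inE; have := mono x; case: ifP => [/eqP->//|_]; lia.
  by have := mono x; rewrite fx3.
have [x|x /andP[fx3 Rx]] := no_blue_copy d_gt2 blockR fI fH.
  by rewrite inE; have := mono x; case: ifP => [/eqP->//|_]; lia.
by have := mono x; rewrite fx3 Rx.
Qed.

(** Transport along an enumeration of [T] lets the 3-graph live on any convenient set of [2 * d]
    points. *)
Lemma blocking_triples_lower_bound (T : finType) (d : nat) (R : {set T} -> bool) :
  #|T| = 2 * d -> 2 < d -> blocking_triples d R ->
  2 * d + 1 <= BR21 (boolean_lattice d).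
Proof.
move=> cT d_gt2 [codegR linkR]; rewrite addn1 ltnNge; apply/negP.
rewrite /BR21; case: ex_minnP => N arrows _ le_N.
have := BR_arrows_leq le_N arrows; apply/negP.
pose g (i : 'I_(2 * d)) : T := enum_val (cast_ord (esym cT) i).
have gI : injective g by move=> i j /enum_val_inj /cast_ord_inj.
apply: (@blocking_triples_noarrow _ (fun A => R (g @: A))) => //; split.
  move=> G E cG cE GE.
  have [|||z] := codegR (g @: G) (g @: E); rewrite ?card_imset //.
    by rewrite imset_disjoint.
  by case/imsetP=> i iE -> nR; exists i; rewrite // imsetU1.
move=> v E cE vE.
have [||x [y [/imsetP[i iE ->] /imsetP[j jE ->] ij Rij]]] := linkR (g v) (g @: E).
- by rewrite card_imset.
- by rewrite mem_imset.
by exists i, j; rewrite imsetU1 imsetU !imset_set1; split=> //; apply: contraNneq ij => ->.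
Qed.

(** * The 3-graph on two copies of a cyclic group *)

Section TwoHalves.
Context (n : nat).
Local Notation vertex := (bool * 'I_n.+1)%type.

Definition half (h : bool) : {set vertex} := [set x | x.1 == h].

(* With opposite signs on the two halves, [x + y = z] across the halves is the
   symmetric condition that the signed sum vanishes. *)
Definition signed (x : vertex) : 'I_n.+1 := if x.1 then x.2 else (- x.2)%R.

Definition two_halves (A : {set vertex}) : bool :=
  [exists h, A \subset half h] || (\sum_(x in A) signed x == 0)%R.

Lemma card_half h : #|half h| = n.+1.
Proof.
rewrite -[RHS]card_ord -cardsT -(card_imset setT (f := pair h)) => [|i j []//].
apply: eq_card => -[k i]; rewrite !inE /=; apply/eqP/imsetP => [-> | [j _ []]//].
by exists i.
Qed.

Lemma card_setI_half (E : {set vertex}) :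
  #|E| = #|E :&: half true| + #|E :&: half false|.
Proof.
rewrite -(cardsID (half true) E); congr (_ + _); apply: eq_card => -[[] i];
  by rewrite !inE //= andbC.
Qed.

(** As a natural number, [b + b] is [a] or [a + n.+1], so [b] is half of one of these. *)
Lemma card_double_eq (a : 'I_n.+1) : #|[set b | (b + b == a)%R]| <= 2.
Proof.
apply: leq_trans (_ : #|[set inord a./2; inord (a + n.+1)./2 : 'I_n.+1]| <= 2).
  apply/subset_leq_card/subsetP => b; rewrite !inE -!val_eqE /=.
  have [lt_b lt_a] := (ltn_ord b, ltn_ord a).
  have [lt_bb|le_bb] := ltnP (b + b) n.+1.
    by rewrite modn_small // => /eqP <-; rewrite addnn doubleK inordK ?eqxx.
  rewrite -{1}(subnK le_bb) modnDr modn_small; last by lia.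
  move=> /eqP ebb; rewrite -ebb subnK // addnn doubleK [inord b]inord_val.
  by rewrite eqxx orbT.
by rewrite cards2; case: (_ != _).
Qed.

(** A pair inside one half is completed to a red triple by at most [n.-1] points there and one in
    the other half; a pair across, by at most one point in each half. With [n > 1], both totals are
    at most [n]. *)
Lemma two_halves_codegree (G E : {set vertex}) :
  1 < n -> #|G| = 2 -> #|E| = n.+1 -> [disjoint G & E] ->
  exists2 z, z \in E & ~~ two_halves (z |: G).
Proof.
move=> n_gt1 cG cE GE; apply/exists_inP; apply: contraPT cE => /exists_inPn.
move=> red; apply/eqP; rewrite neq_ltn; apply/orP; left.
have E1 h : ~~ (G \subset half h) -> #|E :&: half h| <= 1.
  move=> nGh; apply/card_le1P => z /setIP[zE zh] z'.
  apply/idP/idP => [/setIP[z'E z'h]|/eqP->]; last by rewrite inE zE.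
  (* As [G] is not inside half [h], only the sum condition can make the triple red, and it
     determines the added point. *)
  have sum0 u : u \in E -> u \in half h -> (signed u + \sum_(x in G) signed x = 0)%R.
    move=> uE uh; have uG : u \notin G by apply: contraTN uE => /(disjointFr GE) ->.
    have := red u uE; rewrite negbK => /orP[/existsP[k]|]; last by rewrite big_setU1 // => /eqP.
    rewrite subUset sub1set => /andP[uk Gk]; case/negP: nGh.
    by move: uh uk; rewrite !inE => /eqP<- /eqP->.
  have := etrans (sum0 z zE zh) (esym (sum0 z' z'E z'h)) => /addIr.
  move: zh z'h; rewrite !inE /signed; case: (z) (z') => [k i] [k' j] /= /eqP-> /eqP->.
  by case: h {nGh sum0} => [|/oppr_inj] ->.
have E2 h : G \subset half h -> #|E :&: half h| <= n.-1.
  move=> Gh; have : #|G :|: (E :&: half h)| <= n.+1.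
    by apply: leq_trans (eq_leq (card_half h)); rewrite subset_leq_card // subUset Gh subsetIr.
  rewrite cardsU cG (_ : G :&: (E :&: half h) = set0) ?cards0; first by lia.
  by rewrite setIA (disjoint_setI0 GE) set0I.
have nG : (G \subset half true) -> (G \subset half false) -> false.
  have /card_gt0P[x xG] : 0 < #|G| by rewrite cG.
  by move=> /subsetP/(_ x xG) + /subsetP/(_ x xG); rewrite !inE => /eqP->.
rewrite card_setI_half.
have [Gt|/E1] := boolP (G \subset half true); have [Gf|/E1] := boolP (G \subset half false).
- by have := nG Gt Gf.
- by have := E2 _ Gt; lia.
- by have := E2 _ Gf; lia.
- lia.
Qed.

(** Two points of [E] in the half of [v] suffice. Otherwise the other half contains at least [n]
    points of [E], and this set meets its reflection in at least [2 * n - n.+1] points; [n > 3]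
    makes that exceed the at most two fixed points. *)
Lemma two_halves_link (v : vertex) (E : {set vertex}) :
  3 < n -> #|E| = n.+1 -> v \notin E ->
  exists x y, [/\ x \in E, y \in E, x != y & two_halves (v |: [set x; y])].
Proof.
case: v => h a n_gt3 cE vE.
have [/card_gt1P[x [y [/setIP[xE xh] /setIP[yE yh] xy]]]|le1] := ltnP 1 #|E :&: half h|.
  exists x, y; split=> //; apply/orP; left; apply/existsP; exists h.
  by rewrite !subUset !sub1set xh yh inE eqxx.
pose F := [set b | (~~ h, b) \in E].
have cF : n <= #|F|.
  have -> : #|F| = #|E :&: half (~~ h)|.
    rewrite -(card_imset _ (f := pair (~~ h))) => [|i j []//].
    apply: eq_card => -[k b]; rewrite !inE /=; apply/imsetP/andP => /= [[c cF [-> ->]]|[kE /eqP ek]].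
      by move: cF; rewrite inE.
    by exists b; rewrite ?inE -?ek.
  by move: cE le1; rewrite card_setI_half; case: (h) => /=; lia.
pose D := F :&: [set (a - b)%R | b in F].
(* [b |-> a - b] is an involution; an element of [D] that it moves gives the pair. *)
have cD : 2 < #|D|.
  have := cardsU F [set (a - b)%R | b in F].
  rewrite (card_imset _ (f := fun b => (a - b)%R)) => [|b c /addrI/oppr_inj//].
  have := subset_leq_card (subsetT (F :|: [set (a - b)%R | b in F])).
  have := subset_leq_card (subsetIl F [set (a - b)%R | b in F]).
  rewrite -/D cardsT card_ord; move: cF.
  by move: #|_ :|: _| #|D| #|F| => u k m; lia.
have /subsetPn[b /setIP[bF /imsetP[c cF' eb]]] : ~~ (D \subset [set b | (b + b == a)%R]).
  by apply: contraL cD => /subset_leq_card le; rewrite -leqNgt (leq_trans le) ?card_double_eq.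
have bca : (b + c = a)%R by rewrite eb subrK.
rewrite inE -{1}bca (inj_eq (addrI b)) => bc.
rewrite !inE in bF cF'; exists (~~ h, b), (~~ h, c); split=> //.
  by apply: contraNneq bc => -[->].
apply/orP; right; rewrite big_setU1 ?big_setU1 ?big_set1 /=; last 2 first.
- by rewrite inE; apply: contraNneq bc => -[->].
- by rewrite !inE !xpair_eqE; case: (h).
by rewrite /signed /= -bca; case: (h); rewrite /= -?opprD ?subrr ?addNr.
Qed.

End TwoHalves.

(** * Exhaustive verification for d = 3 and d = 4 *)

Fixpoint all_seqs (d n : nat) (P : seq nat -> bool) : bool :=
  if d is d'.+1 then all (fun i => all_seqs d' n (fun s => P (i :: s))) (iota 0 n)
  else P [::].

Lemma all_seqsP (d n : nat) (P : seq nat -> bool) (s : seq nat) :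
  all_seqs d n P -> size s = d -> all (fun i => i < n) s -> P s.
Proof.
elim: d s P => [|d IHd] [|i s] P //= /allP allP [sz] /andP[lt_in sn].
by apply: (IHd s (fun s => P (i :: s))) => //; apply: allP; rewrite mem_iota.
Qed.

(** Sets become duplicate-free lists of naturals so that [vm_compute] can run the check: [g] lists
    the pair, [s] the [d] points. *)
Definition sum_codegree_test (d : nat) (p : pred nat) : bool :=
  all_seqs 2 (2 * d) (fun g => all_seqs d (2 * d) (fun s =>
    uniq (g ++ s) ==> has (fun z => ~~ p (z + sumn g)) s)).

Definition sum_link_test (d : nat) (p : pred nat) : bool :=
  all_seqs 1 (2 * d) (fun g => all_seqs d (2 * d) (fun s =>
    uniq (g ++ s) ==>
    has (fun x => has (fun y => (x != y) && p (sumn g + (x + y))) s) s)).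

Lemma enum_ord_seqP (n : nat) (A B : {set 'I_n}) :
  [/\ size (map val (enum A)) = #|A|, all (fun i => i < n) (map val (enum A)),
      sumn (map val (enum A)) = \sum_(i in A) i &
      [disjoint A & B] -> uniq (map val (enum A) ++ map val (enum B))].
Proof.
split=> [||| AB].
- by rewrite size_map cardE.
- by apply/allP => _ /mapP[i _ ->]; apply: ltn_ord.
- by rewrite sumnE big_map big_enum.
rewrite -map_cat map_inj_uniq ?cat_uniq ?enum_uniq ?andbT //=; last exact: val_inj.
apply/hasPn => i; rewrite !mem_enum => iB.
by apply: contraTN iB => /(disjointFr AB) ->.
Qed.

Lemma sum_blocking_triples (d : nat) (p : pred nat) :
  sum_codegree_test d p -> sum_link_test d p ->
  blocking_triples d (fun A : {set 'I_(2 * d)} => p (\sum_(i in A) i)).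
Proof.
move=> codegT linkT; split=> [G E cG cE GE | v E cE vE].
  have [sG ltG sumG uGE] := enum_ord_seqP G E; have [sE ltE _ _] := enum_ord_seqP E E.
  have := all_seqsP (all_seqsP codegT (etrans sG cG) ltG) (etrans sE cE) ltE.
  rewrite uGE //= has_map => /hasP[z]; rewrite mem_enum /= sumG => zE npz.
  by exists z; rewrite // big_setU1 // (disjointFl GE).
have [sv ltv sumv uvE] := enum_ord_seqP [set v] E; have [sE ltE _ _] := enum_ord_seqP E E.
have := all_seqsP (all_seqsP linkT (etrans sv (cards1 v)) ltv) (etrans sE cE) ltE.
rewrite uvE ?disjoints1 //= has_map => /hasP[x]; rewrite mem_enum /= => xE.
rewrite has_map => /hasP[y]; rewrite mem_enum /= sumv big_set1 => yE /andP[xy pv].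
exists x, y; split=> //; rewrite big_setU1 ?big_setU1 ?big_set1 ?inE //.
by apply: contra vE => /orP[]/eqP->.
Qed.

Theorem theorem2p10 (d : nat) (hd : 3 <= d <= 8 \/ 13 <= d) :
  2 * d + 1 <= BR21 (boolean_lattice d).
Proof.
have d_gt2 : 2 < d by case: hd => [/andP[]|/(leq_trans _)->].
have [d_gt4|d_le4] := ltnP 4 d.
  (* With [d = n.+1], the type ['I_n.+1] carries the group structure of Z_d. *)
  case: d d_gt2 d_gt4 {hd} => [//|n] d_gt2 n_gt3.
  apply: (@blocking_triples_lower_bound _ _ (@two_halves n)) => //.
    by rewrite card_prod card_bool card_ord.
  split=> [G E|v E]; [apply: two_halves_codegree; lia | exact: two_halves_link].
(* Here the reflection argument guarantees only [d - 2 <= 2] points, which may all be fixed;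
   residues of sums replace the two halves. *)
have [->|->] : d = 3 \/ d = 4 by move: d_gt2 d_le4; case: d {hd} => [|[|[|[|[|?]]]]] //; [left|right].
  have block3 : blocking_triples 3 (fun A : {set 'I_(2 * 3)} =>
      (\sum_(i in A) i) %% 6 \in [:: 0; 1; 4]).
    by apply: (sum_blocking_triples (p := fun m => m %% 6 \in [:: 0; 1; 4])); vm_compute.
  by apply: blocking_triples_lower_bound block3; rewrite ?card_ord.
(* The modulus 9 is one more than the number of points, 0 to 7. *)
have block4 : blocking_triples 4 (fun A : {set 'I_(2 * 4)} =>
    (\sum_(i in A) i) %% 9 \in [:: 0; 1; 3]).
  by apply: (sum_blocking_triples (p := fun m => m %% 9 \in [:: 0; 1; 3])); vm_compute.
by apply: blocking_triples_lower_bound block4; rewrite ?card_ord.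
Qed.
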